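(* Let $\mathcal{Q}=(Q,\&)$ be a quantale that satisfies the law of double negation. Then flat ideals coincide with irreducible ideals; that is, for every $\mathcal{Q}$-ordered set $A$, a fuzzy lower set of $A$ is a flat ideal if and only if it is an irreducible ideal.
   Context: A quantale $\mathcal{Q}=(Q,\&)$ is always assumed integral and commutative: $Q$ is a complete lattice (bottom $0$, top $1$) and $\&$ is a commutative associative operation on $Q$ with unit $1$ that distributes over arbitrary joins. Its implication $\to$ is defined by $p\&q\le r\iff q\le p\to r$. $\mathcal{Q}$ satisfies the law of double negation if $(p\to0)\to0=p$ for all $p\in Q$. A $\mathcal{Q}$-ordered set is a set $A$ with a map $A(-,-):A\times A\to Q$ such that $A(x,x)=1$ and $A(y,z)\&A(x,y)\le A(x,z)$ for all $x,y,z\in A$. A fuzzy lower set of $A$ is a map $\phi:A\to Q$ with $\phi(y)\&A(x,y)\le\phi(x)$ for all $x,y$; a fuzzy upper set is a map $\psi:A\to Q$ with $A(x,y)\&\psi(x)\le\psi(y)$ for all $x,y$. Joins and meets of maps $A\to Q$ are pointwise. For fuzzy lower sets, $\mathrm{sub}_A(\phi_1,\phi_2)=\bigwedge_{x\in A}(\phi_1(x)\to\phi_2(x))$. For a fuzzy lower set $\phi$ and a fuzzy upper set $\psi$, $\phi\otimes\psi=\bigvee_{x\in A}\phi(x)\&\psi(x)$. A map $\lambda:A\to Q$ is inhabited if $\bigvee_{a\in A}\lambda(a)=1$. A fuzzy lower set $\phi$ of $A$ is an irreducible ideal if it is inhabited and $\mathrm{sub}_A(\phi,\phi_1\vee\phi_2)=\mathrm{sub}_A(\phi,\phi_1)\vee\mathrm{sub}_A(\phi,\phi_2)$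 for all fuzzy lower sets $\phi_1,\phi_2$ of $A$. It is a flat ideal if it is inhabited and $\phi\otimes(\psi_1\wedge\psi_2)=(\phi\otimes\psi_1)\wedge(\phi\otimes\psi_2)$ for all fuzzy upper sets $\psi_1,\psi_2$ of $A$. *)

(* Defs.v *)
From HB Require Import structures.
From mathcomp Require Import all_boot all_order.
From mathcomp Require Import mathcomp_extra boolp classical_sets.

Set Implicit Arguments.
Unset Strict Implicit.
Unset Printing Implicit Defensive.

Import Order.TTheory.

Local Open Scope classical_set_scope.
Local Open Scope order_scope.

HB.mixin Record TBLattice_isComplete d Q of Order.TBLattice d Q := {
  qsup : set Q -> Q;
  qsup_isLub : forall S : set Q, isLub S (qsup S);
}.

#[short(type="completeLatticeType")]
HB.structure Definition CompleteLattice d :=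
  { Q of Order.TBLattice d Q & TBLattice_isComplete d Q }.

(* Commutativity is built in, so distributivity is required on one side only;
   the unit is the top element (integrality). *)
HB.mixin Record CompleteLattice_isQuantale d Q of CompleteLattice d Q := {
  qmul : Q -> Q -> Q;
  qmulA : associative qmul;
  qmulC : commutative qmul;
  qmul1q : left_id \top qmul;
  qmul_qsupr : forall (p : Q) (S : set Q),
    qmul p (qsup S) = qsup [set qmul p q | q in S];
}.

#[short(type="quantaleType")]
HB.structure Definition Quantale d :=
  { Q of CompleteLattice d Q & CompleteLattice_isQuantale d Q }.

Definition qinf d (Q : completeLatticeType d) (S : set Q) : Q :=
  qsup (lbound S).

Lemma le_qinf d (Q : completeLatticeType d) (S : set Q) (p : Q) :
  p <= qinf S <-> lbound S p.
Proof.
have [ub le] := qsup_isLub (lbound S).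
split=> [ple q Sq|/ub//].
by apply: le_trans ple _; apply: le => r; exact.
Qed.

Section Quantale_theory.
Context d (Q : quantaleType d).

Definition qimp (p r : Q) : Q := qsup [set q | qmul p q <= r].

Lemma qmul_qimp (p q r : Q) : (qmul p q <= r) = (q <= qimp p r).
Proof.
have [ub le] := qsup_isLub [set q | qmul p q <= r].
apply/idP/idP => [/ub//|qle].
have mono : qmul p q <= qmul p (qimp p r).
  have -> : qimp p r = qsup [set q; qimp p r].
    apply/eqP; rewrite eq_le; apply/andP; split.
      by apply: (qsup_isLub _).1; right.
    by apply: (qsup_isLub _).2 => s [->|->].
  by rewrite qmul_qsupr; apply: (qsup_isLub _).1; exists q => //; left.
apply: le_trans mono _.
by rewrite qmul_qsupr; apply: (qsup_isLub _).2 => s [t + <-].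
Qed.

End Quantale_theory.

Definition double_negation d (Q : quantaleType d) : Prop :=
  forall p : Q, qimp (qimp p \bot) \bot = p.

Record qOrderedSet d (Q : quantaleType d) := QOrderedSet {
  qos_sort :> Type;
  qhom : qos_sort -> qos_sort -> Q;
  qhom_refl : forall x, qhom x x = \top;
  qhom_trans : forall x y z, qmul (qhom y z) (qhom x y) <= qhom x z;
}.

Section Ideals.
Context d (Q : quantaleType d) (A : qOrderedSet Q).
Implicit Types phi psi lambda : A -> Q.

Definition fuzzy_lower_set phi : Prop :=
  forall x y : A, qmul (phi y) (qhom x y) <= phi x.

Definition fuzzy_upper_set psi : Prop :=
  forall x y : A, qmul (qhom x y) (psi x) <= psi y.

Definition inhabited_map lambda : Prop := qsup (range lambda) = \top.

Definition fsub phi1 phi2 : Q := qinf (range (fun x => qimp (phi1 x) (phi2 x))).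

Definition ftensor phi psi : Q := qsup (range (fun x => qmul (phi x) (psi x))).

Definition irreducible_ideal phi : Prop :=
  [/\ fuzzy_lower_set phi,
      inhabited_map phi &
      forall phi1 phi2, fuzzy_lower_set phi1 -> fuzzy_lower_set phi2 ->
        fsub phi (fun x => phi1 x `|` phi2 x) =
        fsub phi phi1 `|` fsub phi phi2].

Definition flat_ideal phi : Prop :=
  [/\ fuzzy_lower_set phi,
      inhabited_map phi &
      forall psi1 psi2, fuzzy_upper_set psi1 -> fuzzy_upper_set psi2 ->
        ftensor phi (fun x => psi1 x `&` psi2 x) =
        ftensor phi psi1 `&` ftensor phi psi2].

End Ideals.

(* Main.v *)
Require Import Defs.
From mathcomp Require Import all_boot all_order.
From mathcomp Require Import boolp classical_sets.

(** Negation [p |-> (p -> 0)] turns tensors into inclusions: by currying,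
    [sub(phi, ~ psi) = ~ (phi (x) psi)] holds in every quantale
    ([fsub_qneg]).  Under the law of double negation, negation is moreover an
    order-reversing involution of [Q], so it satisfies both De Morgan laws
    ([qneg_join], [qneg_meet]), and, acting pointwise, it exchanges fuzzy lower
    sets and fuzzy upper sets ([qneg_upper_set], [qneg_lower_set]).  Hence
    negating the equation that defines flatness at [psi1, psi2] gives the
    equation that defines irreducibility at [~ psi1, ~ psi2]; since every fuzzy
    lower set is the negation of a fuzzy upper set and negation is injective,
    the two families of equations are equivalent. *)

Section Negation.
Context {d : Order.disp_t} {Q : quantaleType d}.
Implicit Types p q r : Q.
Import Order.TTheory.
Local Open Scope classical_set_scope.
Local Open Scope order_scope.

Lemma qsup_le (S : set Q) p : qsup S <= p <-> ubound S p.
Proof.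
have [ub le] := qsup_isLub S; split=> [leSp q Sq|/le//].
exact: le_trans (ub _ Sq) leSp.
Qed.

Lemma le_qmul2l p q r : q <= r -> qmul p q <= qmul p r.
Proof. by move=> leqr; rewrite qmul_qimp (le_trans leqr)// -qmul_qimp. Qed.

Definition qneg p : Q := qimp p \bot.

Lemma le_qneg p q : (q <= qneg p) = (qmul p q <= \bot).
Proof. by rewrite -qmul_qimp. Qed.

(** The Galois connection of negation with itself, as [&] is commutative. *)
Lemma le_qnegC p q : (q <= qneg p) = (p <= qneg q).
Proof. by rewrite !le_qneg qmulC. Qed.

Lemma qneg_anti p q : p <= q -> qneg q <= qneg p.
Proof. by move=> lepq; rewrite le_qnegC (le_trans lepq)// le_qnegC. Qed.

Lemma qneg_join p q : qneg (p `|` q) = qneg p `&` qneg q.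
Proof.
apply/eqP; rewrite eq_le lexI !qneg_anti ?leUl ?leUr//=.
by rewrite le_qnegC leUx !(le_qnegC (_ `&` _)) leIl leIr.
Qed.

Lemma qneg_meet (dneg : double_negation Q) p q :
  qneg (p `&` q) = qneg p `|` qneg q.
Proof. by rewrite -[RHS]dneg -/(qneg _) -/(qneg _) qneg_join /qneg !dneg. Qed.

Context {A : qOrderedSet Q}.
Implicit Types phi psi : A -> Q.

(** [p & A(x,y) & psi(x) <= 0] for [p = ~ psi(y)]: the middle and last factors
    multiply to at most [psi(y)]. *)
Lemma qneg_upper_set psi :
  fuzzy_upper_set psi -> fuzzy_lower_set (fun x => qneg (psi x)).
Proof.
move=> psiU x y; rewrite le_qneg qmulC -qmulA.
apply: le_trans (le_qmul2l _ _ _ (psiU x y)) _.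
by rewrite qmulC -le_qneg.
Qed.

Lemma qneg_lower_set phi :
  fuzzy_lower_set phi -> fuzzy_upper_set (fun x => qneg (phi x)).
Proof.
move=> phiL x y; rewrite le_qneg qmulA qmulC.
apply: le_trans (le_qmul2l _ _ _ (phiL x y)) _.
by rewrite qmulC -le_qneg.
Qed.

(** Both sides are the largest [p] with [phi(x) & psi(x) & p <= 0] for all
    [x]. *)
Lemma fsub_qneg phi psi :
  fsub phi (fun x => qneg (psi x)) = qneg (ftensor phi psi).
Proof.
have curry p x :
    (p <= qimp (phi x) (qneg (psi x))) = (qmul (phi x) (psi x) <= qneg p).
  by rewrite -qmul_qimp !le_qneg qmulA (qmulC (psi x)) qmulC.
have leE p : p <= fsub phi (fun x => qneg (psi x)) <->
    p <= qneg (ftensor phi psi).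
  rewrite le_qnegC; split.
    move=> /le_qinf lep; apply/qsup_le => _ [x _ <-].
    by rewrite -curry; apply: lep; exists x.
  move=> /qsup_le lep; apply/le_qinf => _ [x _ <-].
  by rewrite curry; apply: lep; exists x.
by apply/eqP; rewrite eq_le; apply/andP; split; apply/leE.
Qed.

End Negation.

Theorem proposition3p21 (d : Order.disp_t) (Q : quantaleType d)
    (Q_dneg : double_negation Q) (A : qOrderedSet Q) (phi : A -> Q)
    (phi_lower : fuzzy_lower_set phi) :
  flat_ideal phi <-> irreducible_ideal phi.
Proof.
have negK : cancel (@qneg d Q) qneg by exact: Q_dneg.
have fsub_join (psi1 psi2 : A -> Q) :
    fsub phi (fun x => Order.join (qneg (psi1 x)) (qneg (psi2 x))) =
    qneg (ftensor phi (fun x => Order.meet (psi1 x) (psi2 x))).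
  by rewrite -fsub_qneg; congr fsub; apply/funext => x; rewrite qneg_meet.
split=> -[_ phi_inh phi_eq]; split=> // f1 f2 f1P f2P.
  have fK (f : A -> Q) : f = fun x => qneg (qneg (f x)).
    by apply/funext => x; rewrite negK.
  rewrite (fK f1) (fK f2) fsub_join !fsub_qneg -qneg_meet//.
  by rewrite phi_eq//; exact: qneg_lower_set.
apply: (can_inj negK); rewrite -fsub_join qneg_meet// -!fsub_qneg.
by apply: phi_eq; exact: qneg_upper_set.
Qed.
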